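(* Let $R$ be a commutative PP-ring and let $Q$ be its total quotient ring (which is von Neumann regular). Then the following conditions are equivalent: (1) Each product of singly projective $R$-modules is singly projective; (2) $R^R$ (the product of copies of $R$ indexed by the set $R$) is a singly projective $R$-module; (3) $R$ is a Baer ring; (4) $Q$ satisfies the following mutually equivalent conditions: (i) each product of singly projective $Q$-modules is singly projective; (ii) each product of content $Q$-modules is content; (iii) $Q^Q$ is a singly projective $Q$-module; (iv) $Q^Q$ is a content $Q$-module; (v) $Q$ is a Baer ring; (vi) the intersection of each family of finitely generated ideals of $Q$ is finitely generated; (vii) for each cyclic $Q$-module $C$, $\mathrm{Hom}_Q(C,Q)$ is finitely generated; (viii) $\mathrm{Spec}\,Q$ is extremally disconnected; (5) For each cyclic $R$-module $C$, $C^*=\mathrm{Hom}_R(C,R)$ is finitely generated; (6) $\mathrm{Spec}\,R$ is extremally disconnected; (7) $\mathrm{Min}\,R$ is extremally disconnected.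
   Context: A commutative ring $R$ is a PP-ring if any principal ideal is projective; it is a Baer ring if for any subset $A$ of $R$ the annihilator of $A$ is generated by an idempotent. The total quotient ring of $R$ is the localization of $R$ at the set of its non-zero-divisors. A module $M$ is singly projective if, for any cyclic submodule $N$ of $M$, the inclusion map $N\to M$ factors through a free module. For $x\in M$, the content ideal $\mathrm{c}(x)$ is the intersection of all ideals $A$ for which $x\in AM$; $M$ is a content module if $x\in\mathrm{c}(x)M$ for all $x\in M$. A topological space is extremally disconnected if every open set has an open closure. $\mathrm{Spec}\,R$ is the prime spectrum with the Zariski topology and $\mathrm{Min}\,R$ is its subspace of minimal prime ideals. *)

(* Defs.v *)
From HB Require Import structures.
From mathcomp Require Import all_boot all_order all_algebra.
From mathcomp Require Import all_classical topology.
Set Implicit Arguments.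
Unset Strict Implicit.
Unset Printing Implicit Defensive.
Import GRing.Theory.
Local Open Scope classical_set_scope.
Local Open Scope ring_scope.

(* [comPzRingType] is used throughout, so the zero ring is allowed. *)

Definition von_neumann_regular (R : comPzRingType) : Prop :=
  forall a : R, exists b : R, a * b * a = a.

Definition nonzerodivisors (R : comPzRingType) : set R :=
  [set s : R | GRing.lreg s].

(* [phi : R -> Q] is the localization of [R] at [S]: this determines [Q] up to
   a unique isomorphism under [R]. *)
Definition is_localization (R Q : comPzRingType) (S : set R)
    (phi : {rmorphism R -> Q}) : Prop :=
  [/\ forall s, S s -> exists u : Q, phi s * u = 1,
      forall q : Q, exists r s : R, S s /\ q * phi s = phi r
    & forall r r' : R, phi r = phi r' <-> exists s, S s /\ s * r = s * r'].

Definition is_total_quotient_ring (R Q : comPzRingType)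
    (phi : {rmorphism R -> Q}) : Prop :=
  is_localization (@nonzerodivisors R) phi.

(* A submodule of [M] is an element [N] of the library type [submodClosed M];
   [submod N] is the module it carries. *)
Section Submodule.
Variables (R : pzRingType) (M : lmodType R) (N : submodClosed M).

Definition submod : Type := {x : M | x \in N}.
Definition submod_val (u : submod) : M := sval u.

HB.instance Definition _ := [isSub of submod for submod_val].
HB.instance Definition _ := [Choice of submod by <:].
HB.instance Definition _ := [SubChoice_isSubLmodule of submod by <:].

End Submodule.

Notation ideal R := (submodClosed R^o).

Section BigCap.
Variables (R : pzRingType) (M : lmodType R) (I : Type).
Variable N : I -> submodClosed M.

Definition bigcap_submod : {pred M} := fun x => `[< forall i, x \in N i >].

Lemma bigcap_submod_closed : submod_closed bigcap_submod.
Proof.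
split; first by apply/asboolP => i; exact: rpred0.
move=> a u v /asboolP hu /asboolP hv; apply/asboolP => i.
by apply: rpredD; [apply: rpredZ; exact: hu|exact: hv].
Qed.

HB.instance Definition _ :=
  GRing.isSubmodClosed.Build R M bigcap_submod bigcap_submod_closed.

End BigCap.

(* The library only provides the module [I -> M] for a constant family. *)
Section Product.
Variables (R : pzRingType) (I : Type) (M : I -> lmodType R).

Definition prodmod : Type := forall i, M i.

HB.instance Definition _ := gen_eqMixin prodmod.
HB.instance Definition _ := gen_choiceMixin prodmod.

Implicit Types f g h : prodmod.

Let add f g : prodmod := fun i => f i + g i.
Let opp f : prodmod := fun i => - f i.
Let zero : prodmod := fun i => 0.
Let scale (a : R) f : prodmod := fun i => a *: f i.

Fact prodmod_addA : associative add.
Proof. by move=> f g h; apply: functional_extensionality_dep => i; exact: addrA. Qed.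
Fact prodmod_addC : commutative add.
Proof. by move=> f g; apply: functional_extensionality_dep => i; exact: addrC. Qed.
Fact prodmod_add0 : left_id zero add.
Proof. by move=> f; apply: functional_extensionality_dep => i; exact: add0r. Qed.
Fact prodmod_addN : left_inverse zero opp add.
Proof. by move=> f; apply: functional_extensionality_dep => i; exact: addNr. Qed.

HB.instance Definition _ := GRing.isZmodule.Build prodmod
  prodmod_addA prodmod_addC prodmod_add0 prodmod_addN.

Fact prodmod_scaleA a b f : scale a (scale b f) = scale (a * b) f.
Proof. by apply: functional_extensionality_dep => i; exact: scalerA. Qed.
Fact prodmod_scale1 : left_id 1 scale.
Proof. by move=> f; apply: functional_extensionality_dep => i; exact: scale1r. Qed.
Fact prodmod_scaleDr : right_distributive scale +%R.
Proof. by move=> a f g; apply: functional_extensionality_dep => i; exact: scalerDr. Qed.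
Fact prodmod_scaleDl f : {morph scale^~ f : a b / a + b}.
Proof. by move=> a b; apply: functional_extensionality_dep => i; exact: scalerDl. Qed.

HB.instance Definition _ := GRing.Zmodule_isLmodule.Build R prodmod
  prodmod_scaleA prodmod_scale1 prodmod_scaleDr prodmod_scaleDl.

End Product.

Section Dual.
Variables (R : comPzRingType) (C : lmodType R).

Definition dual : {pred (C -> R^o)} := fun f => `[< linear f >].

Lemma dual_closed : submod_closed dual.
Proof.
split; first by apply/asboolP => a u v; rewrite /= scaler0 addr0.
move=> a f g /asboolP hf /asboolP hg; apply/asboolP => b u v.
have E w : (a *: f + g) w = a *: f w + g w by [].
rewrite !E hf hg !scalerDr !scalerA [a * b]mulrC.
exact: addrACA.
Qed.

(* Hom_R(C, R), as a submodule of the module of all functions C -> R *)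
HB.instance Definition _ :=
  GRing.isSubmodClosed.Build R (C -> R^o) dual dual_closed.

End Dual.

Section Modules.
Variable R : comPzRingType.

Definition cyclic (M : lmodType R) : Prop :=
  exists x : M, forall y : M, exists a : R, y = a *: x.

Definition finitely_generated (M : lmodType R) : Prop :=
  exists (n : nat) (g : 'I_n -> M), forall x : M,
    exists c : 'I_n -> R, x = \sum_(i < n) c i *: g i.

Definition linearly_independent (M : lmodType R) (B : set M) : Prop :=
  forall (s : seq M) (c : M -> R), uniq s -> (forall x, x \in s -> B x) ->
    \sum_(x <- s) c x *: x = 0 -> forall x, x \in s -> c x = 0.

Definition spanning (M : lmodType R) (B : set M) : Prop :=
  forall y : M, exists (s : seq M) (c : M -> R),
    (forall x, x \in s -> B x) /\ y = \sum_(x <- s) c x *: x.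

Definition free_module (M : lmodType R) : Prop :=
  exists B : set M, linearly_independent B /\ spanning B.

Definition projective (P : lmodType R) : Prop :=
  forall (M N : lmodType R) (g : {linear M -> N}) (f : {linear P -> N}),
    (forall y : N, exists x : M, g x = y) ->
    exists h : {linear P -> M}, forall x : P, g (h x) = f x.

Definition singly_projective (M : lmodType R) : Prop :=
  forall N : submodClosed M, cyclic (submod N) ->
    exists (F : lmodType R) (u : {linear submod N -> F}) (v : {linear F -> M}),
      free_module F /\ forall y : submod N, v (u y) = val y.

(* [x] belongs to the submodule A M of [M]. *)
Definition in_ideal_mul (A : ideal R) (M : lmodType R) (x : M) : Prop :=
  exists (n : nat) (a : 'I_n -> R) (m : 'I_n -> M),
    (forall i, (a i : R^o) \in A) /\ x = \sum_(i < n) a i *: m i.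

Definition content (M : lmodType R) (x : M) : ideal R :=
  bigcap_submod (fun A : {A : ideal R | in_ideal_mul A x} => sval A).

Definition content_module (M : lmodType R) : Prop :=
  forall x : M, in_ideal_mul (content x) x.

End Modules.

Definition pp_ring (R : comPzRingType) : Prop :=
  forall A : ideal R, cyclic (submod A) -> projective (submod A).

Definition baer_ring (R : comPzRingType) : Prop :=
  forall A : set R, exists e : R, e * e = e /\
    forall x : R, (forall a, A a -> x * a = 0) <-> exists r : R, x = r * e.

Definition products_singly_projective (R : comPzRingType) : Prop :=
  forall (I : Type) (M : I -> lmodType R),
    (forall i, singly_projective (M i)) -> singly_projective (prodmod M).

Definition products_content (R : comPzRingType) : Prop :=
  forall (I : Type) (M : I -> lmodType R),
    (forall i, content_module (M i)) -> content_module (prodmod M).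

(* R^R: the product of copies of [R] indexed by the underlying set of [R] *)
Definition self_power (R : comPzRingType) : lmodType R :=
  prodmod (fun _ : R => R^o).

Definition intersections_finitely_generated (R : comPzRingType) : Prop :=
  forall (I : Type) (A : I -> ideal R),
    (forall i, finitely_generated (submod (A i))) ->
    finitely_generated (submod (bigcap_submod A)).

Definition cyclic_duals_finitely_generated (R : comPzRingType) : Prop :=
  forall C : lmodType R, cyclic C -> finitely_generated (submod (@dual R C)).

Definition prime_ideal (R : comPzRingType) (P : ideal R) : Prop :=
  ~ ((1 : R^o) \in P) /\
  forall a b : R, (a * b : R^o) \in P -> (a : R^o) \in P \/ (b : R^o) \in P.

Record Spec (R : comPzRingType) : Type :=
  MkSpec { spec_ideal : ideal R ; spec_prime : prime_ideal spec_ideal }.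

Section Zariski.
Variable R : comPzRingType.

HB.instance Definition _ := gen_eqMixin (Spec R).
HB.instance Definition _ := gen_choiceMixin (Spec R).

(* V(A) *)
Definition zero_locus (A : set R) : set (Spec R) :=
  [set P | forall a, A a -> (a : R^o) \in spec_ideal P].

Definition zariski_open : set_system (Spec R) :=
  [set U | exists A : set R, U = ~` zero_locus A].

Lemma zariski_openT : zariski_open setT.
Proof.
exists [set 1]; apply/esym; rewrite -subTset => P _ /=.
by move=> /(_ 1 erefl); case: (spec_prime P).
Qed.

Lemma zariski_openI : setI_closed zariski_open.
Proof.
move=> _ _ [A ->] [B ->].
exists [set c | exists a b, [/\ A a, B b & c = a * b]].
rewrite -setCU; congr (~` _); apply/seteqP; split=> P /=.
  move=> [hA|hB] _ [a [b [Aa Bb ->]]].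
    by rewrite mulrC; exact: (rpredZ (b : R) (hA a Aa)).
  exact: (rpredZ (a : R) (hB b Bb)).
move=> hAB; have [hA|nA] := pselect (zero_locus A P); [by left|right].
move=> b Bb; apply: contrapT => nb; apply: nA => a Aa.
have /(proj2 (spec_prime P))[//|//] : ((a * b : R^o) \in spec_ideal P).
by apply: hAB; exists a, b.
Qed.

Lemma zariski_open_bigcup (I : Type) (U : I -> set (Spec R)) :
  (forall i, zariski_open (U i)) -> zariski_open (\bigcup_i U i).
Proof.
move=> /choice[A UA]; exists (\bigcup_i A i).
rewrite -[LHS]setCK setC_bigcup; congr (~` _); apply/seteqP; split=> P /=.
  by move=> h a [i _ Aa]; have := h i Logic.I; rewrite UA setCK; apply.
by move=> h i _; rewrite UA setCK => a Aa; apply: h; exists i.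
Qed.

HB.instance Definition _ := isOpenTopological.Build (Spec R)
  zariski_openT zariski_openI zariski_open_bigcup.

End Zariski.

Definition minimal_prime (R : comPzRingType) : set (Spec R) :=
  [set P | forall P' : Spec R,
     {subset spec_ideal P' <= spec_ideal P} ->
     {subset spec_ideal P <= spec_ideal P'}].

(* [set_type] carries the subspace topology. *)
Definition MinSpec (R : comPzRingType) : topologicalType :=
  set_type (@minimal_prime R).

Definition extremally_disconnected (T : topologicalType) : Prop :=
  forall U : set T, open U -> open (closure U).

(* Main.v *)
Require Import Defs.
From HB Require Import structures.
From mathcomp Require Import all_boot all_order all_algebra.
From mathcomp Require Import all_classical topology.
Local Open Scope ring_scope.
Set Implicit Arguments.
Unset Strict Implicit.
Unset Printing Implicit Defensive.
Import GRing.Theory.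

(** Over a PP-ring the annihilator of every element of a free module is
    generated by an idempotent, so a module is singly projective iff the
    annihilator of each of its elements is generated by an idempotent; over a
    von Neumann regular ring the content modules have the same
    characterization. Since annihilators in a product are intersections, and
    the annihilator of a subset [A] of [R] is the annihilator of an element of
    [R^R], conditions (1) and (2) say that [R] is a Baer ring. Likewise
    [ann A] is the dual of a cyclic submodule of [R^R], and over a PP-ring a
    finitely generated annihilator is generated by an idempotent.

    On the topological side, the closure of the open set [D(A)], in [Spec R] as
    well as in [Min R], is [V(ann A)]; it is open iff
    [ann A + ann (ann A) = R], i.e. iff [ann A] is generated by an idempotent.
    The passage between the two spectra uses that the elements of a prime [P]
    fixed by an idempotent of [P] form a minimal prime.

    Finally every element of [Q] is the product of an idempotent of [R] and a
    unit, which makes [Q] von Neumann regular and transfers the Baer property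
    between [R] and [Q]. *)

(** * Joins and complements of idempotents *)

Section Idempotents.
Variable R : comPzRingType.
Implicit Types e f r : R.

(** The supremum in the Boolean algebra of idempotents: for idempotent [e] and [f] it generates the
    ideal they generate together. *)
Definition idem_join e f := e + f - e * f.

Lemma idem_joinC e f : idem_join e f = idem_join f e.
Proof. by rewrite /idem_join (addrC e) (mulrC e). Qed.

Lemma mul_idem_joinl e f : e * e = e -> e * idem_join e f = e.
Proof. by move=> ee; rewrite /idem_join mulrBr mulrDr mulrA ee addrK. Qed.

Lemma mul_idem_joinr e f : f * f = f -> f * idem_join e f = f.
Proof. by rewrite idem_joinC; exact: mul_idem_joinl. Qed.

Lemma idem_join_idem e f :
  e * e = e -> f * f = f -> idem_join e f * idem_join e f = idem_join e f.
Proof.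
move=> ee ff; rewrite {1}/idem_join mulrBl mulrDl -mulrA.
by rewrite mul_idem_joinl // !mul_idem_joinr.
Qed.

Lemma mul_idem_join_eq0 e f r : e * e = e -> f * f = f ->
  r * idem_join e f = 0 <-> r * e = 0 /\ r * f = 0.
Proof.
move=> ee ff; split=> [r0|[re rf]].
  split; first by rewrite -[e in LHS](mul_idem_joinl f ee) mulrCA r0 mulr0.
  by rewrite -[f in LHS](mul_idem_joinr e ff) mulrCA r0 mulr0.
by rewrite /idem_join mulrBr mulrDr mulrA re rf mul0r addr0 subr0.
Qed.

Lemma idem_compl e : e * e = e -> (1 - e) * (1 - e) = 1 - e.
Proof. by move=> ee; rewrite mulrBl mul1r mulrBr mulr1 ee subrr subr0. Qed.

Lemma mul_compl_eq0 e r : r * (1 - e) = 0 <-> r * e = r.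
Proof.
rewrite mulrBr mulr1; split=> [/eqP|->]; last by rewrite subrr.
by rewrite subr_eq0 => /eqP <-.
Qed.

End Idempotents.

(** * Linear maps, cyclic submodules and annihilators *)

Lemma pack_linear (R : pzRingType) (U V : lmodType R) (f : U -> V) :
  linear f -> exists g : {linear U -> V}, forall x, g x = f x.
Proof.
move=> f_lin.
pose g : {linear U -> V} := HB.pack f (GRing.isLinear.Build R U V *:%R f f_lin).
by exists g.
Qed.

Section CyclicSubmodule.
Variables (R : pzRingType) (M : lmodType R) (x : M).

Definition line : {pred M} := fun y => `[< exists r, y = r *: x >].

Lemma line_closed : submod_closed line.
Proof.
split; first by apply/asboolP; exists 0; rewrite scale0r.
move=> a _ _ /asboolP[r ->] /asboolP[s ->]; apply/asboolP.
by exists (a * r + s); rewrite scalerDl scalerA.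
Qed.

HB.instance Definition _ := GRing.isSubmodClosed.Build R M line line_closed.

Lemma mem_line r : r *: x \in line.
Proof. by apply/asboolP; exists r. Qed.

Lemma mem_line1 : x \in line.
Proof. by rewrite -[x]scale1r; exact: mem_line. Qed.

Definition line_gen : submod line := exist _ x mem_line1.

Lemma lineE (y : submod line) : exists r, y = r *: line_gen.
Proof. by case: y => y /[dup] /asboolP[r ->] h; exists r; apply: val_inj. Qed.

End CyclicSubmodule.

Lemma cyclic_line (R : comPzRingType) (M : lmodType R) (x : M) :
  cyclic (submod (line x)).
Proof. by exists (line_gen x); exact: lineE. Qed.

Section Annihilator.
Variables (R : comPzRingType) (A : set R).

Definition annihilator : {pred R^o} := fun x : R =>
  `[< forall a, A a -> x * a = 0 >].

Lemma annihilator_closed : submod_closed annihilator.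
Proof.
split; first by apply/asboolP => a _; rewrite mul0r.
move=> c x y /asboolP hx /asboolP hy; apply/asboolP => a Aa.
by rewrite mulrDl hy // -[c *: x]/(c * x) -mulrA hx // mulr0 addr0.
Qed.

HB.instance Definition _ :=
  GRing.isSubmodClosed.Build R R^o annihilator annihilator_closed.

Lemma annihilatorP (x : R) :
  reflect (forall a, A a -> x * a = 0) (x \in annihilator).
Proof. exact: asboolP. Qed.

End Annihilator.

(** Idempotence of the generator comes for free: since [e] lies in the annihilator, the second
    clause at [x := e] gives [e * e = e]. *)
Lemma baerP (R : comPzRingType) : baer_ring R <->
  forall A : set R, exists2 e : R, e \in annihilator A &
    forall x, x \in annihilator A -> x * e = x.
Proof.
split=> baerR A.
  have [e [ee eP]] := baerR A; exists e.
    by apply/annihilatorP/eP; exists 1; rewrite mul1r.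
  by move=> x /annihilatorP/eP[r ->]; rewrite -mulrA ee.
have [e eA eP] := baerR A; exists e; split; first exact: eP.
move=> x; split=> [/annihilatorP/eP<-|[r ->] a Aa]; first by exists x.
by rewrite -mulrA (annihilatorP _ _ eA) ?mulr0.
Qed.

Lemma baer_idem (R : comPzRingType) (A : set R) : baer_ring R ->
  exists2 e : R, e * e = e &
    forall x, (forall a, A a -> x * a = 0) <-> x * e = 0.
Proof.
move=> /(_ A)[e [ee eP]]; exists (1 - e); first exact: idem_compl.
move=> x; rewrite eP mul_compl_eq0; split=> [[r ->]|<-]; last by exists x.
by rewrite -mulrA ee.
Qed.

(** * Support idempotents and singly projective modules *)

Section IdempotentAnnihilator.
Variable R : comPzRingType.

(** Here [e] is the support of [x]: the annihilator of [x] is generated by [1 - e]. Writing it as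
    the annihilator of [e] makes intersections of annihilators easy to combine. *)
Definition ann_idem (M : lmodType R) (x : M) : Prop :=
  exists2 e : R, e * e = e & forall r, r *: x = 0 <-> r * e = 0.

Definition elements_ann_idem : Prop := forall a : R^o, ann_idem a.

Lemma ann_idem_support (M : lmodType R) (x : M) (e : R) :
  e * e = e -> (forall r, r *: x = 0 <-> r * e = 0) -> e *: x = x.
Proof.
move=> ee eP; apply/eqP; rewrite eq_sym -subr_eq0 -{1}[x]scale1r -scalerBl.
by apply/eqP/eP; rewrite mulrBl mul1r ee subrr.
Qed.

Lemma vnr_idem (a : R) : von_neumann_regular R ->
  exists b : R, (a * b) * (a * b) = a * b /\ (a * b) * a = a.
Proof. by move=> /(_ a)[b aba]; exists b; rewrite mulrA aba. Qed.

Lemma vnr_ann_idem : von_neumann_regular R -> elements_ann_idem.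
Proof.
move=> vnrR a; have [b [abab aba]] := vnr_idem a vnrR.
exists (a * b) => // r; split=> [|rab]; first by move=> ra; rewrite mulrA [r * a]ra mul0r.
by rewrite -aba -[_ *: _]/(r * (a * b * a)) mulrA rab mul0r.
Qed.

(** Projectivity splits the surjection from [R] onto [R a]; the splitting embeds [R a] in [R], so
    [a] and its image [e] have the same annihilator. *)
Lemma pp_ann_idem : pp_ring R -> elements_ann_idem.
Proof.
move=> ppR a.
have [|g gE] := @pack_linear _ R^o (submod (line a)) (fun r => r *: line_gen a).
  by move=> c r s; rewrite scalerDl scalerA.
have [|f fE] := @pack_linear _ (submod (line a)) (submod (line a)) id.
  by [].
have [|h hE] := @ppR (line a) (cyclic_line a) _ _ g f.
  by move=> y; have [r ->] := lineE y; exists r; rewrite gE.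
pose e : R := h (line_gen a).
have ea : e * a = a.
  by have /(congr1 val) := hE (line_gen a); rewrite gE fE.
have he r : h (r *: line_gen a) = r * e by rewrite linearZ.
have geneq r : r * a = 0 -> r *: line_gen a = 0 by move=> ra; apply: val_inj.
(* Since [e * a = a], applying [h] gives [e * e = e]. *)
exists e => [|r]; first by rewrite -he; congr (h _); exact: val_inj.
split=> [ra|re]; first by rewrite -he geneq // linear0.
by rewrite -ea -[_ *: _]/(r * (e * a)) mulrA re mul0r.
Qed.

(** The inclusion of [R x] factors through [R] by [r *: x |-> r * e] and [r |-> r *: x]. The
    coefficients chosen by [k] need not be linear, but multiplying them by [e] removes the
    ambiguity, which lies in the annihilator of [x]. *)
Lemma ann_idem_singly_projective (M : lmodType R) :
  (forall x : M, ann_idem x) -> singly_projective M.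
Proof.
move=> annM N [x xP]; have [e ee eP] := annM (val x).
have /choice[k kE] : forall y : submod N, exists r, y = r *: x by [].
have kP r : k (r *: x) * e = r * e.
  apply/eqP; rewrite -subr_eq0 -mulrBl; apply/eqP/eP.
  by rewrite scalerBl -!linearZ -kE subrr.
have [|u uE] := @pack_linear _ (submod N) R^o (fun y => k y * e).
  move=> a y z; rewrite {1}(kE y) {1}(kE z) scalerA -scalerDl kP.
  by rewrite mulrDl -mulrA.
have [|v vE] := @pack_linear _ R^o M (fun r => r *: val x).
  by move=> c r s; rewrite scalerDl scalerA.
exists R^o, u, v; split.
  exists [set 1]%classic; split=> [s c us s1|y]; last first.
    exists [:: 1], (fun=> y); split=> [z|]; first by rewrite inE => /eqP.
    by rewrite big_seq1 -[LHS]mulr1.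
  (* A duplicate-free list with entries in the basis [{1}] is empty or the singleton [[:: 1]]. *)
  have sE : all (pred1 1) s by apply/allP=> z zs; rewrite /= (s1 z zs).
  case: s us s1 sE => [//|z [|w s]] /=; rewrite ?inE; last first.
    by case/andP=> zs _ _ /and3P[/eqP z1 /eqP w1 _]; rewrite z1 w1 eqxx in zs.
  move=> _ _ /andP[/eqP-> _]; rewrite big_seq1 -[_ *: _]/(c 1 * 1) mulr1 => c1 y.
  by rewrite inE => /eqP->.
move=> y; rewrite uE vE {2}(kE y) -scalerA (ann_idem_support ee eP).
by rewrite -linearZ.
Qed.

Lemma seq_ann_idem (s : seq R) : elements_ann_idem ->
  exists2 e : R, e * e = e &
    forall r, (forall a, a \in s -> r * a = 0) <-> r * e = 0.
Proof.
move=> annR; elim: s => [|a s [e ee eP]].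
  by exists 0 => [|r]; rewrite mulr0.
have [f ff fP] := annR a; exists (idem_join f e); first exact: idem_join_idem.
move=> r; rewrite mul_idem_join_eq0 // -eP -fP; split=> [rs|[ra rs] b].
  by split=> [|b bs]; apply: rs; rewrite inE ?eqxx // bs orbT.
by rewrite inE => /orP[/eqP->|/rs].
Qed.

(** By independence, [r] kills [x] iff it kills every coordinate, and finitely many supports have a
    join. *)
Lemma free_ann_idem (F : lmodType R) (x : F) :
  elements_ann_idem -> free_module F -> ann_idem x.
Proof.
move=> annR [B [indB spanB]]; have [s [c [sB ->]]] := spanB x.
(* The spanning list may repeat a basis vector, so multiplicities are absorbed into the
   coefficients. *)
pose c' y := c y *+ count_mem y s.
have -> : \sum_(y <- s) c y *: y = \sum_(y <- undup s) c' y *: y.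
  rewrite -big_undup_iterop_count; apply: eq_bigr => y _.
  by rewrite /c' -scalerMnl.
have [e ee eP] := seq_ann_idem [seq c' y | y <- undup s] annR.
exists e => // r; rewrite -eP scaler_sumr; split=> [rs _ /mapP[y ys ->]|rs].
  apply: (indB _ (fun z => r * c' z) (undup_uniq s)) ys => [z|].
    by rewrite mem_undup; exact: sB.
  by rewrite -[RHS]rs; apply: eq_bigr => z _; rewrite scalerA.
rewrite big_seq big1 // => y ys.
by rewrite scalerA rs ?scale0r //; apply: map_f.
Qed.

(** If the inclusion of [R x] factors through a free module, the first map is injective, so [x] has
    the annihilator of an element of that module. *)
Lemma singly_projectiveP (M : lmodType R) : elements_ann_idem ->
  singly_projective M <-> forall x : M, ann_idem x.
Proof.
move=> annR; split=> [spM x|]; last exact: ann_idem_singly_projective.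
have [F [u [v [freeF uv]]]] := spM (line x) (cyclic_line x).
have [e ee eP] := free_ann_idem (u (line_gen x)) annR freeF.
exists e => // r; rewrite -eP; split=> [rx|].
  have -> : r *: u (line_gen x) = u (r *: line_gen x) by rewrite linearZ.
  by rewrite (_ : r *: _ = 0) ?linear0 //; exact: val_inj.
move=> /(congr1 v); rewrite linearZ linear0 uv; exact.
Qed.

End IdempotentAnnihilator.

(** * Finitely generated ideals with local idempotent units *)

Section Ideals.
Variables (R : comPzRingType) (A : ideal R).
Implicit Types x y r : R.

Lemma ideal_add x y :
  (x : R^o) \in A -> (y : R^o) \in A -> (x + y : R^o) \in A.
Proof. exact: (@rpredD _ A). Qed.

Lemma ideal_mull r x : (x : R^o) \in A -> (r * x : R^o) \in A.
Proof. exact: (@rpredZ _ _ A). Qed.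

Lemma ideal_mulr r x : (x : R^o) \in A -> (x * r : R^o) \in A.
Proof. rewrite mulrC; exact: ideal_mull. Qed.

Lemma ideal_sub x y :
  (x : R^o) \in A -> (y : R^o) \in A -> (x - y : R^o) \in A.
Proof. by move=> xA yA; rewrite -mulN1r; apply: ideal_add => //; exact: ideal_mull. Qed.

End Ideals.

Lemma val_lincomb (R : pzRingType) (M : lmodType R) (N : submodClosed M) (n : nat)
    (c : 'I_n -> R) (g : 'I_n -> submod N) :
  val (\sum_i c i *: g i) = \sum_i c i *: val (g i).
Proof. by rewrite linear_sum; apply: eq_bigr => i _; rewrite linearZ. Qed.

Section LocalIdempotents.
Variables (R : comPzRingType) (A : ideal R).

(** Such an ideal is a directed union of ideals generated by idempotents, so when finitely generated
    it is itself generated by one. *)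
Definition locally_unital : Prop :=
  forall a : R, (a : R^o) \in A ->
    exists e : R, [/\ (e : R^o) \in A, e * e = e & a * e = a].

Lemma seq_unital (s : seq R) : locally_unital ->
  (forall a, a \in s -> (a : R^o) \in A) ->
  exists e : R, [/\ (e : R^o) \in A, e * e = e & forall a, a \in s -> a * e = a].
Proof.
move=> locA; elim: s => [_|a s IHs sA].
  by exists 0; rewrite mulr0; split=> //; exact: rpred0.
have [|e [eA ee eP]] := IHs; first by move=> b bs; apply: sA; rewrite inE bs orbT.
have [|f [fA ff fP]] := locA a; first by apply: sA; rewrite inE eqxx.
exists (idem_join e f); split; last 1 first.
- move=> b; rewrite inE => /orP[/eqP->|/eP <-].
    by rewrite -fP -mulrA mul_idem_joinr.
  by rewrite -mulrA mul_idem_joinl.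
- by apply: ideal_sub; [exact: ideal_add|exact: ideal_mull].
- exact: idem_join_idem.
Qed.

Lemma finitely_generated_unital : locally_unital ->
  finitely_generated (submod A) ->
  exists2 e : R, (e : R^o) \in A & forall a : R, (a : R^o) \in A -> a * e = a.
Proof.
move=> locA [n [g gP]].
have [_ /mapP[i _ ->]|e [eA _ eP]] :=
  @seq_unital [seq (val (g i) : R) | i <- enum 'I_n] locA; first exact: valP.
exists e => // a aA; have [c /(congr1 val)] := gP (exist _ a aA).
rewrite val_lincomb -[val _]/a => ->.
rewrite mulr_suml; apply: eq_bigr => i _.
rewrite -[_ *: _]/(c i * (val (g i) : R)).
by rewrite -mulrA eP //; apply: map_f; rewrite mem_enum.
Qed.

Lemma unital_finitely_generated (e : R) : (e : R^o) \in A ->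
  (forall a : R, (a : R^o) \in A -> a * e = a) -> finitely_generated (submod A).
Proof.
move=> eA eP; exists 1, (fun=> exist _ (e : R^o) eA) => x.
exists (fun=> val x); rewrite big_ord1; apply: val_inj.
by rewrite linearZ; apply/esym; apply: eP; exact: valP.
Qed.

End LocalIdempotents.

Lemma vnr_locally_unital (R : comPzRingType) (A : ideal R) :
  von_neumann_regular R -> locally_unital A.
Proof.
move=> vnrR a aA; have [b [abab aba]] := vnr_idem a vnrR.
exists (a * b); split=> //; last by rewrite mulrC.
exact: ideal_mulr.
Qed.

(** The support [e] of [x] has the same annihilator as [x], so it is again killed by [A], and it
    fixes [x]. *)
Lemma annihilator_locally_unital (R : comPzRingType) (A : set R) :
  elements_ann_idem R -> locally_unital (annihilator A).
Proof.
move=> annR x /annihilatorP xA; have [e ee eP] := annR x.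
exists e; split=> //; last by rewrite mulrC; exact: (ann_idem_support ee eP).
by apply/annihilatorP => a Aa; rewrite mulrC; apply/eP; rewrite -(xA a Aa) mulrC.
Qed.

(** * Content modules over a von Neumann regular ring *)

Section Content.
Variable R : comPzRingType.
Hypothesis vnrR : von_neumann_regular R.

Lemma in_ideal_mul_idem (A : ideal R) (M : lmodType R) (x : M) :
  in_ideal_mul A x -> exists e : R, [/\ (e : R^o) \in A, e * e = e & e *: x = x].
Proof.
move=> [n [a [m [aA ->]]]].
have [_ /mapP[i _ ->]//|e [eA ee eP]] :=
  @seq_unital _ A [seq a i | i <- enum 'I_n] (vnr_locally_unital vnrR).
exists e; split=> //; rewrite scaler_sumr; apply: eq_bigr => i _.
by rewrite scalerA mulrC eP //; apply: map_f; rewrite mem_enum.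
Qed.

Lemma idem_in_ideal_mul (A : ideal R) (M : lmodType R) (x : M) (e : R) :
  (e : R^o) \in A -> e *: x = x -> in_ideal_mul A x.
Proof. by move=> eA ex; exists 1, (fun=> e), (fun=> x); rewrite big_ord1. Qed.

(** The content of [x] is generated by the support of [x], the least idempotent fixing [x]. *)
Lemma content_moduleP (M : lmodType R) :
  content_module M <-> forall x : M, ann_idem x.
Proof.
split=> contM x.
  have [e [/asboolP e_min ee ex]] := in_ideal_mul_idem (contM x).
  exists e => // r; split=> [rx|re]; last by rewrite -ex scalerA re scale0r.
  have [b [rb rbr]] := vnr_idem r vnrR.
  have f_x : (1 - r * b) *: x = x.
    by rewrite scalerBl scale1r mulrC -scalerA rx scaler0 subr0.
  (* As [1 - r * b] fixes [x], the ideal [L] contains the content of [x], hence [e]; and [r] kills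
     [L]. *)
  pose L : ideal R := line (1 - r * b : R^o).
  have Lx : in_ideal_mul L x by apply: idem_in_ideal_mul f_x; exact: mem_line1.
  have /asboolP[c ->] := e_min (exist _ L Lx); rewrite -[_ *: _]/(c * (1 - r * b)) mulrCA.
  by rewrite mulrBr mulr1 [r * (r * b)]mulrC rbr subrr mulr0.
have [e ee eP] := contM x.
apply: (@idem_in_ideal_mul _ _ _ e); last exact: (ann_idem_support ee eP).
apply/asboolP => -[A /= /in_ideal_mul_idem[f [fA ff fx]]].
suff <- : e * f = e by exact: ideal_mull.
apply/mul_compl_eq0; rewrite mulrC; apply/eP.
by rewrite scalerBl scale1r fx subrr.
Qed.

End Content.

(** * Products of modules and duals of cyclic modules *)

Section Products.
Variable R : comPzRingType.

Lemma prodmod_scaleE (I : Type) (M : I -> lmodType R) (x : prodmod M) r :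
  r *: x = 0 <-> forall i, r *: x i = 0.
Proof.
split=> [rx i|rx]; last exact: functional_extensionality_dep.
by rewrite -[LHS]/((r *: x) i) rx.
Qed.

(** The annihilator of a tuple is the annihilator of the set of supports of its components. *)
Lemma prodmod_ann_idem (I : Type) (M : I -> lmodType R) (x : prodmod M) :
  baer_ring R -> (forall i, ann_idem (x i)) -> ann_idem x.
Proof.
move=> baerR annx.
have /choice[e eP] : forall i, exists e : R, forall r, r *: x i = 0 <-> r * e = 0.
  by move=> i; have [e _ eP] := annx i; exists e.
have [f ff fP] := baer_idem (range e) baerR; exists f => // r.
rewrite -fP prodmod_scaleE; split=> [rx _ [i _ <-]|re i]; first exact/eP.
by apply/eP/re; exists i.
Qed.

Lemma self_power_ann_idem : (forall x : self_power R, ann_idem x) -> baer_ring R.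
Proof.
move=> ann_pow; apply/baerP => A.
(* The tuple lists the elements of [A], padded with zeros, so its annihilator is that of [A]. *)
pose x : self_power R := fun a => if `[< A a >] then a else 0.
have [e ee eP] := ann_pow x.
have annE r : r \in annihilator A <-> r * e = 0.
  rewrite -eP prodmod_scaleE; split=> [/annihilatorP rA a|rx].
    by rewrite /x; case: asboolP => [/rA|_] //; rewrite scaler0.
  apply/annihilatorP => a Aa; have := rx a.
  by rewrite /x; case: asboolP.
exists (1 - e); first by apply/annE; rewrite mulrBl mul1r ee subrr.
by move=> r /annE re; rewrite mulrBr mulr1 re subr0.
Qed.

Lemma baer_products_singly_projective : elements_ann_idem R ->
  baer_ring R -> products_singly_projective R.
Proof.
move=> annR baerR I M spM; apply: ann_idem_singly_projective => x.
by apply: prodmod_ann_idem => // i; have /(singly_projectiveP _ annR) := spM i; exact.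
Qed.

Lemma self_power_singly_projective : elements_ann_idem R ->
  products_singly_projective R -> singly_projective (self_power R).
Proof. by move=> annR; apply=> _; exact: ann_idem_singly_projective. Qed.

Lemma self_power_singly_projective_baer : elements_ann_idem R ->
  singly_projective (self_power R) -> baer_ring R.
Proof. by move=> annR /(singly_projectiveP _ annR); exact: self_power_ann_idem. Qed.

(* If [x] is the tuple listing the elements of [annihilator A], then
   [f |-> f x] identifies the dual of the line through [x] with
   [annihilator A]. *)
Lemma duals_finitely_generated_annihilator (A : set R) :
  cyclic_duals_finitely_generated R -> finitely_generated (submod (annihilator A)).
Proof.
move=> dualR; pose x : self_power R := fun y => if y \in annihilator A then y else 0.
have x_ann y : y \in annihilator A -> x y = y by rewrite /x => ->.
have xA a : A a -> a *: x = 0.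
  move=> Aa; apply/prodmod_scaleE => y; rewrite /x.
  case: ifPn => [/annihilatorP yA|_]; last exact: scaler0.
  by rewrite -[_ *: _]/(a * y) mulrC yA.
have [n [g gP]] := dualR _ (cyclic_line x).
have gA i : (val (g i) (line_gen x) : R^o) \in annihilator A.
  apply/annihilatorP => a Aa; have /asboolP g_lin := valP (g i).
  have [h hE] := pack_linear g_lin.
  rewrite -hE mulrC -[_ * _]/(a *: h (line_gen x)) -linearZ.
  by rewrite (_ : a *: _ = 0) ?linear0 //; apply: val_inj; exact: xA.
exists n, (fun i => exist (fun z => z \in annihilator A) _ (gA i)) => -[y yA].
(* Evaluation at the coordinate [y] is the functional that takes the value [y] at [x]. *)
pose f := fun z : submod (line x) => (val z y : R^o).
have f_dual : f \in @dual R (submod (line x)) by apply/asboolP => a u v.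
have [c /(congr1 val)] := gP (exist _ f f_dual).
rewrite val_lincomb -[val _]/f => fE; exists c; apply: val_inj.
rewrite val_lincomb -[val _]/y; have -> : y = f (line_gen x) by rewrite /f /= x_ann.
by rewrite fE fct_sumE.
Qed.

Lemma duals_finitely_generated_baer : elements_ann_idem R ->
  cyclic_duals_finitely_generated R -> baer_ring R.
Proof.
move=> annR dualR; apply/baerP => A.
have [] := finitely_generated_unital (@annihilator_locally_unital _ A annR)
  (duals_finitely_generated_annihilator A dualR).
by move=> e eA eP; exists e.
Qed.

(** For [C = R x], evaluation at [x] identifies the dual with the double annihilator of [x]. Its
    idempotent generator [e] corresponds to the functional [r *: x |-> r * e], which generates the
    dual. *)
Lemma baer_duals_finitely_generated :
  baer_ring R -> cyclic_duals_finitely_generated R.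
Proof.
move=> baerR C [x xP].
have /choice[k kE] : forall y : C, exists r, y = r *: x by [].
have [e /annihilatorP eA eP] := (baerP R).1 baerR [set r | r *: x = 0]%classic.
have kP r : k (r *: x) * e = r * e.
  apply/eqP; rewrite -subr_eq0 -mulrBl mulrC; apply/eqP/eA.
  by rewrite /= scalerBl -kE subrr.
pose g := fun y : C => (k y * e : R^o).
have g_dual : g \in @dual R C.
  apply/asboolP => a y z; rewrite /g {1}(kE y) {1}(kE z) scalerA -scalerDl kP.
  by rewrite mulrDl -mulrA.
exists 1, (fun=> exist _ g g_dual) => -[f f_dual].
have /asboolP f_lin := f_dual; have [h hE] := pack_linear f_lin.
exists (fun=> f x); rewrite big_ord1; apply: val_inj.
rewrite linearZ /=; apply: funext => y.
rewrite -[RHS]/(f x * (k y * e)) mulrCA eP; last first.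
  apply/annihilatorP => r /= rx.
  by rewrite -hE mulrC -[_ * _]/(r *: h x) -linearZ rx linear0.
by rewrite {1}(kE y) -hE linearZ hE.
Qed.

End Products.

(** * Intersections of finitely generated ideals *)

Lemma vnr_baer_intersections (R : comPzRingType) : von_neumann_regular R ->
  baer_ring R -> intersections_finitely_generated R.
Proof.
move=> vnrR baerR I A fgA.
have /choice[e eP] : forall i, exists e : R,
    (e : R^o) \in A i /\ forall a : R, (a : R^o) \in A i -> a * e = a.
  move=> i; have [] := finitely_generated_unital (vnr_locally_unital vnrR) (fgA i).
  by move=> e; exists e.
(* An ideal generated by the idempotent [e i] is the annihilator of [1 - e i], so the intersection
   is again an annihilator. *)
have capE x : x \in bigcap_submod A <->
    x \in annihilator [set 1 - e i | i in setT]%classic.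
  split=> [/asboolP xA|/annihilatorP xA].
    by apply/annihilatorP => _ [i _ <-]; apply/mul_compl_eq0; exact: (eP i).2.
  apply/asboolP => i; have /xA/mul_compl_eq0 <- :
      [set 1 - e i | i in setT]%classic (1 - e i) by exists i.
  by apply: ideal_mull; exact: (eP i).1.
have [f fA fP] := (baerP R).1 baerR [set 1 - e i | i in setT]%classic.
by apply: (@unital_finitely_generated _ _ f); [exact/capE|move=> a /capE/fP].
Qed.

Lemma vnr_intersections_baer (R : comPzRingType) : von_neumann_regular R ->
  intersections_finitely_generated R -> baer_ring R.
Proof.
move=> vnrR fgR; apply/baerP => A.
have annR := vnr_ann_idem vnrR.
(* The annihilator of [A] is the intersection of the annihilators of its elements, each generated by
   an idempotent. *)
pose I := {a | A a}; pose B (i : I) : ideal R := annihilator [set sval i]%classic.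
have fgB i : finitely_generated (submod (B i)).
  have [e ee eP] := annR (sval i); apply: (@unital_finitely_generated _ _ (1 - e)).
    by apply/annihilatorP => _ ->; apply/eP; rewrite mulrBl mul1r ee subrr.
  move=> a /annihilatorP /(_ _ erefl) /eP ae.
  by rewrite mulrBr mulr1 ae subr0.
have [e /asboolP eB eP] :=
  finitely_generated_unital (vnr_locally_unital vnrR) (fgR I B fgB).
exists e; first by apply/annihilatorP => a Aa; exact: (annihilatorP _ _ (eB (exist _ a Aa))).
move=> x /annihilatorP xA; apply: eP; apply/asboolP => -[a Aa].
by apply/annihilatorP => _ ->; exact: xA.
Qed.

(** * Prime ideals, minimal primes and closures of open sets *)

Section Sum.
Variables (R : pzRingType) (M : lmodType R) (N N' : submodClosed M).

Definition sum_submod : {pred M} := fun z =>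
  `[< exists x y, [/\ x \in N, y \in N' & z = x + y] >].

Lemma sum_submod_closed : submod_closed sum_submod.
Proof.
split; first by apply/asboolP; exists 0, 0; rewrite !rpred0 addr0.
move=> a _ _ /asboolP[x [y [xN yN' ->]]] /asboolP[x' [y' [x'N y'N' ->]]].
apply/asboolP; exists (a *: x + x'), (a *: y + y').
by rewrite !rpredD ?rpredZ // scalerDr addrACA.
Qed.

HB.instance Definition _ :=
  GRing.isSubmodClosed.Build R M sum_submod sum_submod_closed.

Lemma sum_submodl x : x \in N -> x \in sum_submod.
Proof. by move=> xN; apply/asboolP; exists x, 0; rewrite addr0 rpred0. Qed.

Lemma sum_submodr y : y \in N' -> y \in sum_submod.
Proof. by move=> yN'; apply/asboolP; exists 0, y; rewrite add0r rpred0. Qed.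

End Sum.

Section Primes.
Variable R : comPzRingType.
Implicit Types (P : Spec R) (a b e r x : R).

Lemma exists_prime (I : ideal R) : (1 : R^o) \notin I ->
  exists P, {subset I <= spec_ideal P}.
Proof.
(* Zorn's lemma is applied to sets joined with [I], so that the union of the empty chain is also
   admissible. *)
move=> I1; pose extend (A : set R^o) : {pred R^o} := fun x => `[< A x \/ x \in I >].
have extendP A x : reflect (A x \/ x \in I) (x \in extend A) by exact: asboolP.
pose proper A := submod_closed (extend A) /\ (1 : R^o) \notin extend A.
have [F F_proper F_chain|A [[A_closed A1] A_max]] := @Zorn_bigcup R^o proper.
  have F_closed (X : set R^o) (c : R) u v :
      F X -> u \in extend X -> v \in extend X ->
      c *: u + v \in extend (\bigcup_(X in F) X)%classic.
    move=> FX uX vX; have [[_ /(_ c _ _ uX vX) /extendP X_lin] _] := F_proper X FX.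
    by apply/extendP; case: X_lin => [h|]; [left; exists X|right].
  split; last first.
    apply/extendP => -[[X /F_proper[_ /extendP X1] ?]|]; last exact/negP.
    by apply: X1; left.
  split; first by apply/extendP; right; exact: rpred0.
  move=> c u v /extendP[[X FX Xu]|Iu] /extendP[[Y FY Yv]|Iv].
  - have [XY|YX] := F_chain X Y FX FY.
      by apply: (F_closed Y) => //; apply/extendP; left => //; exact: XY.
    by apply: (F_closed X) => //; apply/extendP; left => //; exact: YX.
  - by apply: (F_closed X) => //; apply/extendP; [left|right].
  - by apply: (F_closed Y) => //; apply/extendP; [right|left].
  - by apply/extendP; right; apply: ideal_add => //; exact: ideal_mull.
pose J : ideal R := HB.pack (extend A)
  (GRing.isSubmodClosed.Build R R^o (extend A) A_closed).
(* By maximality of [A], adjoining to [J] any element outside it yields the unit ideal. *)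
have J_max a : (a : R^o) \notin J -> (1 : R^o) \in sum_submod J (line (a : R^o)).
  move=> Ja; apply: contrapT => /negP J1.
  have AB x : A x -> x \in sum_submod J (line (a : R^o)).
    by move=> Ax; apply: sum_submodl; apply/extendP; left.
  apply: (A_max [set x | x \in sum_submod J (line (a : R^o))]%classic).
    split=> [x /AB //|BA]; case/negP: Ja; apply/extendP; left.
    by apply: BA; apply: sum_submodr; exact: mem_line1.
  have BE x : (x \in extend [set x | x \in sum_submod J (line (a : R^o))]%classic) =
      (x \in sum_submod J (line (a : R^o))).
    apply/extendP/idP => [[//|xI]|]; last by left.
    by apply: sum_submodl; apply/extendP; right.
  split; last by rewrite BE.
  split=> [|c u v]; first by rewrite BE; exact: rpred0.
  by rewrite !BE => uB vB; apply: ideal_add => //; exact: ideal_mull.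
have J_prime : prime_ideal J.
  split=> [|a b abJ]; first exact/negP.
  have [|Ja] := boolP ((a : R^o) \in J); [by left|right].
  have /asboolP[j [_ [jJ /asboolP[r ->] E]]] := J_max a Ja.
  have -> : b = b * j + r * (a * b).
    by rewrite -[LHS]mulr1 [X in b * X]E mulrDr mulrCA [b * a]mulrC.
  by apply: ideal_add; exact: ideal_mull.
by exists (MkSpec J_prime) => x xI; apply/extendP; right.
Qed.

Lemma prime_compl P e : e * e = e ->
  ((1 - e : R) : R^o) \in spec_ideal P <-> ~ (e : R^o) \in spec_ideal P.
Proof.
move=> ee; have [P1 P_mul] := spec_prime P; split=> [fP eP|eNP].
  by apply: P1; rewrite -[1](subrK e); exact: ideal_add.
have [|//|//] := P_mul e (1 - e).
by rewrite mulrBr mulr1 ee subrr rpred0.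
Qed.

(** The ideal generated by the idempotents of [I]. *)
Definition idem_part (I : ideal R) : {pred R^o} := fun a : R =>
  `[< exists e, [/\ e * e = e, (e : R^o) \in I & a * e = a] >].

Lemma idem_part_closed (I : ideal R) : submod_closed (idem_part I).
Proof.
split; first by apply/asboolP; exists 0; rewrite !mulr0 rpred0.
move=> c a b /asboolP[e [ee eI ae]] /asboolP[f [ff fI bf]].
apply/asboolP; exists (idem_join e f); split; first exact: idem_join_idem.
  by apply: ideal_sub; [exact: ideal_add|exact: ideal_mull].
rewrite mulrDl -[c *: a]/(c * a) -mulrA.
have -> : a * idem_join e f = a by rewrite -ae -mulrA mul_idem_joinl.
by have -> : b * idem_join e f = b by rewrite -bf -mulrA mul_idem_joinr.
Qed.

HB.instance Definition _ (I : ideal R) :=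
  GRing.isSubmodClosed.Build R R^o (idem_part I) (idem_part_closed I).

Lemma idem_part_sub (I : ideal R) : {subset idem_part I <= I}.
Proof. by move=> a /asboolP[e [_ eI <-]]; exact: ideal_mull. Qed.

Hypothesis annR : elements_ann_idem R.

Lemma idem_part_prime P : prime_ideal (idem_part (spec_ideal P)).
Proof.
have [P1 P_mul] := spec_prime P; split=> [/idem_part_sub //|a b].
move=> /asboolP[g [gg gP abg]].
have [e ee eP] := annR a; have [f ff fP] := annR b.
(* As [1 - g] kills [a * b], it kills the product of the supports, so [e * f] is a multiple of
   [g]. *)
have efP : (e * f : R^o) \in spec_ideal P.
  have -> : e * f = e * f * g; last exact: ideal_mull.
  apply/esym/mul_compl_eq0; rewrite mulrAC; apply/fP.
  rewrite -[_ *: _]/(e * (1 - g) * b) -mulrA [LHS]mulrC; apply/eP.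
  by rewrite -[_ *: _]/((1 - g) * b * a) -mulrA [b * a]mulrC [LHS]mulrC; apply/mul_compl_eq0.
case: (P_mul _ _ efP) => h; [left|right]; apply/asboolP.
  exists e; split=> //; rewrite mulrC; exact: (ann_idem_support ee eP).
exists f; split=> //; rewrite mulrC; exact: (ann_idem_support ff fP).
Qed.

Definition min_below P : Spec R := MkSpec (idem_part_prime P).

(** A prime contains exactly one of [e] and [1 - e], so a prime inside [P] contains every idempotent
    of [P]. *)
Lemma min_below_minimal P : @minimal_prime R (min_below P).
Proof.
move=> P' P'P a /asboolP[e [ee eP <-]]; apply: ideal_mull.
apply: contrapT => /(prime_compl P' ee) /P'P /idem_part_sub.
by move=> /(prime_compl P ee); apply.
Qed.

(** If the support [e] of [r] is nonzero, some prime [P] contains [1 - e]. But [r] in [min_below P]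
    is fixed by an idempotent of [P], which then also fixes [e] and puts [e] in [P]. *)
Lemma minimal_primes_eq0 r :
  (forall P, minimal_prime P -> (r : R^o) \in spec_ideal P) -> r = 0.
Proof.
move=> r_min; have [e ee eP] := annR r; have er := ann_idem_support ee eP.
have [/asboolP[c c1]|/exists_prime[P P_sub]] :=
  boolP ((1 : R^o) \in line ((1 - e : R) : R^o)).
  have e1 : e * 1 = 0.
    rewrite [X in _ * X]c1 -[GRing.scale _ _]/(c * (1 - e)).
    by rewrite mulrCA mulrBr mulr1 ee subrr mulr0.
  by rewrite -er -[e]mulr1 e1 scale0r.
have /P_sub/(prime_compl P ee) [] := mem_line1 ((1 - e : R) : R^o).
have /asboolP[g [gg gP rg]] := r_min _ (@min_below_minimal P).
have <- : e * g = e; last exact: ideal_mull.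
apply/mul_compl_eq0; rewrite mulrC; apply/eP.
by rewrite -[_ *: _]/((1 - g) * r) mulrC; apply/mul_compl_eq0.
Qed.

(* Covers both [Spec R] and its subspace [Min R]. *)
Variables (T : topologicalType) (i : T -> Spec R).
Hypothesis open_T : forall U : set T,
  open U <-> exists A : set R, U = [set t | ~ zero_locus A (i t)]%classic.
Hypothesis min_T : forall P, minimal_prime P -> exists t, i t = P.

(** If [x] kills [A], then [D(x)] misses [D(A)]. Conversely, if [c] is outside a prime containing
    the annihilator of [A], then [c * a <> 0] for some [a] in [A], and a minimal prime avoiding
    [c * a] lies in both [D(c)] and [D(A)]. *)
Lemma closure_zariski_open (A : set R) :
  closure [set t | ~ zero_locus A (i t)]%classic =
  [set t | {subset annihilator A <= spec_ideal (i t)}]%classic.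
Proof.
have open_nbhs_T (C : set R) (t : T) : ~ zero_locus C (i t) ->
    nbhs t [set t | ~ zero_locus C (i t)]%classic.
  by move=> tC; apply: open_nbhs_nbhs; split=> //; apply/open_T; exists C.
apply/seteqP; split=> t /=.
  move=> t_cl x /annihilatorP xA; apply: contrapT => xt.
  have [|s [/= sA sx]] := t_cl _ (@open_nbhs_T [set x]%classic t _).
    by move=> /(_ x erefl).
  apply: sA => a Aa; have [_ s_mul] := spec_prime (i s).
  have [||//] := s_mul x a; first by rewrite xA // rpred0.
  by move=> xs; case: sx => _ ->.
move=> t_ann B; rewrite nbhsE => -[U [/open_T[C ->] /= tC] UB].
have [c Cc ct] : exists2 c : R, C c & ~ (c : R^o) \in spec_ideal (i t).
  by apply: contrapT => h; apply: tC => c Cc; apply: contrapT => ct; apply: h; exists c.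
have [a Aa ca] : exists2 a : R, A a & c * a <> 0.
  apply: contrapT => h; apply: ct; apply: t_ann; apply/annihilatorP => a Aa.
  by apply: contrapT => ca; apply: h; exists a.
have [P P_min caP] : exists2 P, minimal_prime P & ~ (c * a : R^o) \in spec_ideal P.
  apply: contrapT => h; apply: ca; apply: minimal_primes_eq0 => P P_min.
  by apply: contrapT => caP; apply: h; exists P.
have [s sP] := min_T P_min; exists s; split=> /=; last apply: UB => /=.
  by rewrite sP => /(_ a Aa) aP; apply: caP; exact: ideal_mull.
by rewrite sP => /(_ c Cc) cP; apply: caP; exact: ideal_mulr.
Qed.

Lemma extremally_disconnectedP : extremally_disconnected T <-> baer_ring R.
Proof.
split=> [edT|/baerP baerR U /open_T[A ->]]; last first.
  have [e eA eP] := baerR A.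
  have ee : e * e = e by exact: eP.
  rewrite closure_zariski_open; apply/open_T; exists [set 1 - e]%classic.
  apply/seteqP; split=> t /=.
    by move=> tA /(_ _ erefl)/(prime_compl _ ee); apply; exact: tA.
  move=> tNe x xA.
  rewrite -(eP x xA); apply: ideal_mull; apply: contrapT => et; apply: tNe => _ ->.
  exact/prime_compl.
apply/baerP => A.
have /open_T[B BE] :
    open [set t | {subset annihilator A <= spec_ideal (i t)}]%classic.
  by rewrite -closure_zariski_open; apply: edT; apply/open_T; exists A.
have BP t : {subset annihilator A <= spec_ideal (i t)} <-> ~ zero_locus B (i t).
  by rewrite -[~ _]/([set t | ~ zero_locus B (i t)]%classic t) -BE.
(* [K] is the double annihilator of [A]. It contains [B], because every minimal prime contains the
   annihilator of [A] or [B]. *)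
pose K : ideal R := annihilator [set x : R | (x : R^o) \in annihilator A]%classic.
have BK b : B b -> (b : R^o) \in K.
  move=> Bb; apply/annihilatorP => x /= xA; apply: minimal_primes_eq0 => P P_min.
  have [t tP] := min_T P_min.
  have [tA|/BP/contrapT tB] := pselect ({subset annihilator A <= spec_ideal (i t)}).
    by apply: ideal_mull; rewrite -tP; exact: tA.
  by apply: ideal_mulr; rewrite -tP; exact: tB.
(* A prime [P] over the sum would give a minimal prime containing both summands, as these are
   locally unital. It would lie in the closed set [V(ann A)], which equals [D(B)], and yet contain
   [B]. *)
have : (1 : R^o) \in sum_submod (annihilator A) K.
  apply: contrapT => /negP/exists_prime[P P_sub].
  have [t tP] := min_T (@min_below_minimal P).
  have /BP tB : {subset annihilator A <= spec_ideal (i t)}.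
    rewrite tP => x xA; apply/asboolP.
    have [e [eA ee xe]] := annihilator_locally_unital annR xA.
    by exists e; split=> //; apply: P_sub; exact: sum_submodl.
  apply: tB => b /BK bK; rewrite tP; apply/asboolP.
  have [e [eK ee be]] := annihilator_locally_unital annR bK.
  by exists e; split=> //; apply: P_sub; exact: sum_submodr.
move=> /asboolP[x [y [xA /annihilatorP yK E]]]; exists x => // z zA.
by rewrite -[RHS]mulr1 [X in _ = z * X]E mulrDr [z * y]mulrC yK // addr0.
Qed.

End Primes.

Lemma spec_extremally_disconnectedP (R : comPzRingType) : elements_ann_idem R ->
  extremally_disconnected (Spec R) <-> baer_ring R.
Proof.
move=> annR; apply: (@extremally_disconnectedP _ annR (Spec R) id) => [//|P _].
by exists P.
Qed.

Lemma minspec_extremally_disconnectedP (R : comPzRingType) : elements_ann_idem R ->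
  extremally_disconnected (MinSpec R) <-> baer_ring R.
Proof.
move=> annR; apply: (@extremally_disconnectedP _ annR (MinSpec R) set_val).
  move=> U; split=> [[V [A ->] <-]|[A ->]]; first by exists A.
  by exists (~` zero_locus A)%classic => //; exists A.
by move=> P P_min; exists (exist _ P (mem_set P_min)).
Qed.

(** * The total quotient ring *)

Section TotalQuotientRing.
Variables (R Q : comPzRingType) (phi : {rmorphism R -> Q}).
Hypothesis annR : elements_ann_idem R.
Hypothesis locQ : is_total_quotient_ring phi.

Lemma mulr_inv_eq0 (y u w : Q) : u * w = 1 -> y * u = 0 -> y = 0.
Proof. by move=> uw yu; rewrite -[y]mulr1 -uw mulrA yu mul0r. Qed.

Lemma total_quotient_inj : injective phi.
Proof. by have [_ _ phiE] := locQ; move=> r r' /phiE[s [s_reg /s_reg]]. Qed.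

(* Every [a] in [R] factors as [a = e (a + 1 - e)] where [e] is its support
   idempotent and [a + 1 - e] is a non-zero-divisor. *)
Lemma total_quotientE (q : Q) :
  exists e u w, [/\ e * e = e, u * w = 1 & q = phi e * u].
Proof.
have [phi_unit phi_frac _] := locQ.
have [a [s [/phi_unit[v sv] qs]]] := phi_frac q.
have [e ee eP] := annR a; have ea : e * a = a := ann_idem_support ee eP.
pose t := a + (1 - e).
have et : e * t = a by rewrite mulrDr ea mulrBr mulr1 ee subrr addr0.
have /phi_unit[t' tt'] : nonzerodivisors t.
  move=> x y txy; apply/eqP; rewrite -subr_eq0; apply/eqP; set z := x - y.
  have tz : t * z = 0 by rewrite mulrBr txy subrr.
  have ze : z * e = 0.
    by apply/eP; rewrite -[_ *: _]/(z * a) mulrC -et -mulrA tz mulr0.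
  have za : a * z = 0 by rewrite mulrC; apply/eP.
  by move: tz; rewrite mulrDl za add0r mulrBl mul1r mulrC ze subr0.
exists e, (phi t * v), (t' * phi s); split=> //.
  by rewrite mulrACA tt' mul1r mulrC.
by rewrite mulrA -rmorphM et -qs -mulrA sv mulr1.
Qed.

Lemma total_quotient_vnr : von_neumann_regular Q.
Proof.
move=> q; have [e [u [w [ee uw ->]]]] := total_quotientE q; exists w.
by rewrite -[_ * u * w]mulrA uw mulr1 mulrA -rmorphM ee.
Qed.

Lemma total_quotient_baer : baer_ring R <-> baer_ring Q.
Proof.
split=> /baerP baer; apply/baerP => A.
  (* Each element of [A] is replaced by its associated idempotents of [R]; their annihilator in [R]
     generates that of [A] in [Q]. *)
  pose B := [set e : R | exists q u w, [/\ A q, u * w = 1 & q = phi e * u]]%classic.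
  have [f /annihilatorP fB fP] := baer B.
  exists (phi f).
    apply/annihilatorP => q Aq; have [e [u [w [_ uw qE]]]] := total_quotientE q.
    by rewrite qE mulrA -rmorphM fB ?rmorph0 ?mul0r //; exists q, u, w.
  move=> x; have [d [v [v' [_ vv' ->]]]] := total_quotientE x.
  move=> /annihilatorP dA; rewrite mulrAC -rmorphM fP //.
  apply/annihilatorP => e [q [u [w [Aq uw qE]]]].
  apply: total_quotient_inj; rewrite rmorph0 rmorphM.
  apply: (mulr_inv_eq0 vv'); apply: (mulr_inv_eq0 uw).
  by rewrite -(dA q Aq) qE !mulrA; congr (_ * _); exact: mulrAC.
have [q /annihilatorP qA qP] := baer (phi @` A)%classic.
have [e [u [w [ee uw qE]]]] := total_quotientE q; exists e.
  apply/annihilatorP => a Aa; apply: total_quotient_inj; rewrite rmorph0 rmorphM.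
  by apply: (mulr_inv_eq0 uw); rewrite mulrAC -qE qA //; exists a.
move=> x /annihilatorP xA; apply: total_quotient_inj; rewrite rmorphM.
(* Inserting the factor [q] suffices, since [q * phi e = q]. *)
have {1}<- : phi x * q = phi x; last first.
  rewrite -mulrA qE mulrAC -rmorphM ee -qE; apply: qP.
  by apply/annihilatorP => _ [a Aa <-]; rewrite -rmorphM xA // rmorph0.
by apply: qP; apply/annihilatorP => _ [a Aa <-]; rewrite -rmorphM xA // rmorph0.
Qed.

End TotalQuotientRing.

(** * Each condition as a form of the Baer property *)

Section Equivalences.
Variable R : comPzRingType.
Hypothesis annR : elements_ann_idem R.

Lemma products_singly_projectiveP : products_singly_projective R <-> baer_ring R.
Proof.
split; last exact: baer_products_singly_projective.
by move=> /(self_power_singly_projective annR); exact: self_power_singly_projective_baer.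
Qed.

Lemma self_power_singly_projectiveP :
  singly_projective (self_power R) <-> baer_ring R.
Proof.
split; first exact: self_power_singly_projective_baer.
move=> baerR; apply: self_power_singly_projective => //.
exact/products_singly_projectiveP.
Qed.

Lemma cyclic_duals_finitely_generatedP :
  cyclic_duals_finitely_generated R <-> baer_ring R.
Proof.
split; first exact: duals_finitely_generated_baer.
exact: baer_duals_finitely_generated.
Qed.

Hypothesis vnrR : von_neumann_regular R.

Lemma content_singly_projective (M : lmodType R) :
  content_module M <-> singly_projective M.
Proof. by rewrite content_moduleP // singly_projectiveP. Qed.

Lemma products_contentP : products_content R <-> baer_ring R.
Proof.
rewrite -products_singly_projectiveP; split=> prodR I M hM.
  by apply/content_singly_projective/prodR => i; apply/content_singly_projective.
by apply/content_singly_projective/prodR => i; apply/content_singly_projective.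
Qed.

Lemma self_power_contentP : content_module (self_power R) <-> baer_ring R.
Proof. by rewrite content_singly_projective self_power_singly_projectiveP. Qed.

Lemma intersections_finitely_generatedP :
  intersections_finitely_generated R <-> baer_ring R.
Proof.
by split; [exact: vnr_intersections_baer|exact: vnr_baer_intersections].
Qed.

End Equivalences.

Theorem theorem2p8 (R Q : comPzRingType) (phi : {rmorphism R -> Q})
    (ppR : pp_ring R) (locQ : is_total_quotient_ring phi) :
  von_neumann_regular Q /\
  [<-> products_singly_projective Q;
       products_content Q;
       singly_projective (self_power Q);
       content_module (self_power Q);
       baer_ring Q;
       intersections_finitely_generated Q;
       cyclic_duals_finitely_generated Q;
       extremally_disconnected (Spec Q)] /\
  [<-> products_singly_projective R;
       singly_projective (self_power R);
       baer_ring R;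
       (products_singly_projective Q /\ products_content Q /\
        singly_projective (self_power Q) /\ content_module (self_power Q) /\
        baer_ring Q /\ intersections_finitely_generated Q /\
        cyclic_duals_finitely_generated Q /\
        extremally_disconnected (Spec Q));
       cyclic_duals_finitely_generated R;
       extremally_disconnected (Spec R);
       extremally_disconnected (MinSpec R)].
Proof.
have annR := pp_ann_idem ppR.
have vnrQ := total_quotient_vnr annR locQ; have annQ := vnr_ann_idem vnrQ.
have baerE := propext (total_quotient_baer annR locQ).
(* Each condition becomes the Baer property of its ring, and finally that of [R], which leaves
   propositional tautologies. *)
rewrite !(propext (products_singly_projectiveP _)) //.
rewrite !(propext (self_power_singly_projectiveP _)) //.
rewrite (propext (products_contentP _ _)) // (propext (self_power_contentP _ _)) //.
rewrite (propext (intersections_finitely_generatedP _)) //.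
rewrite !(propext (cyclic_duals_finitely_generatedP _)) //.
rewrite !(propext (spec_extremally_disconnectedP _)) //.
rewrite (propext (minspec_extremally_disconnectedP _)) // -baerE.
by split=> //; split; tfae; tauto.
Qed.
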